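(* Let $k$ be an algebraically closed field of characteristic zero. Let $f\in k(t,x)$ be such that, over the algebraic closure $\overline{k(t)}$ of $k(t)$, $$f=\sum_{i=1}^m\sum_{j=1}^{n_i}\frac{\alpha_{i,j}}{(x-\beta_i)^j},$$ where $\alpha_{i,j},\beta_i\in\overline{k(t)}$, $\alpha_{i,n_i}\neq 0$ for each $i$, and $\beta_i-\beta_{i'}\notin\mathbb{Z}$ for $i\neq i'$. Then there exist a nonzero operator $L\in k(t)\langle D_t\rangle$ and $g\in k(t,x)$ with $L(f)=\Delta_x(g)$ if and only if all the $\beta_i$ lie in $k$.
   Context: $D_t=\partial/\partial t$ on $k(t,x)$; $S_x(h(t,x))=h(t,x+1)$ and $\Delta_x=S_x-1$. $k(t)\langle D_t\rangle$ is the ring of linear differential operators $\sum_\ell e_\ell D_t^\ell$ with $e_\ell\in k(t)$, acting on $k(t,x)$. *)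

(* Defs.v *)
From HB Require Import structures.
From mathcomp Require Import all_boot all_order all_algebra.
From mathcomp Require Import generic_quotient ring.

Set Implicit Arguments.
Unset Strict Implicit.
Unset Printing Implicit Defensive.

Import GRing.Theory.
Local Open Scope ring_scope.
Local Open Scope quotient_scope.

Notation "x %:F" := (FracField.tofrac x) : ring_scope.

(* k(t) is [ratfun k] and k(t,x) is [ratfun (ratfun k)], that is k(t)(x): the
   inner 'X is t, the outer 'X is x. *)
Notation ratfun k := {fraction {poly k}}.

(* [frac_map] and [frac_deriv] are computed on the representative chosen by
   [repr]; [frac_mapE] and [frac_derivE] show that the choice is irrelevant. *)
Definition frac_map (R S : idomainType) (f : R -> S) (u : {fraction R}) :
    {fraction S} :=
  (f \n_(repr u))%:F / (f \d_(repr u))%:F.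

Definition frac_deriv (R : idomainType) (d : R -> R) (u : {fraction R}) :
    {fraction R} :=
  let p := \n_(repr u) in
  let q := \d_(repr u) in
  (d p * q - p * d q)%:F / q%:F ^+ 2.

Definition shift_poly1 (F : fieldType) (p : {poly F}) : {poly F} :=
  p \Po ('X + 1).

Definition Sx (F : fieldType) : ratfun F -> ratfun F :=
  frac_map (@shift_poly1 F).

Definition Deltax (F : fieldType) (u : ratfun F) : ratfun F := Sx u - u.

Definition Dt0 (k : fieldType) : ratfun k -> ratfun k :=
  frac_deriv (@deriv k).

(* D_t acts coefficientwise on k(t)[x], so that D_t(x) = 0. *)
Definition Dt (k : fieldType) : ratfun (ratfun k) -> ratfun (ratfun k) :=
  frac_deriv (map_poly (@Dt0 k)).

(* k(t)<D_t> is a free left k(t)-module on the powers of D_t: the operator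
   \sum_l e_l D_t^l is encoded by the polynomial with coefficients e_l. Only
   the module structure of {poly _} is meaningful here, not its product. *)
Notation diffop k := {poly ratfun k}.

Definition diffop_app (k : fieldType) (L : diffop k) (u : ratfun (ratfun k)) :
    ratfun (ratfun k) :=
  \sum_(l < size L) (L`_l)%:P%:F * iter l (@Dt k) u.

Definition cst_kt (k : fieldType) (c : k) : ratfun k := c%:P%:F.

(* The inclusion of k(t)(x) in K(x) induced by iota : k(t) -> K. *)
Definition extend_x (F K : fieldType) (iota : F -> K) : ratfun F -> ratfun K :=
  frac_map (map_poly iota).

Definition is_algebraic_closure (F : fieldType) (K : closedFieldType)
    (iota : {rmorphism F -> K}) : Prop :=
  forall z : K, algebraicOver iota z.

(* c / (x - b)^j in K(x) *)
Definition simple_fraction (K : fieldType) (c b : K) (j : nat) : ratfun K :=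
  c%:P%:F / ('X - b%:P)%:F ^+ j.

Section FracTheory.
Variable R : idomainType.
Implicit Types (a b : R) (u v : {fraction R}).

Lemma frac_repr u : u = (\n_(repr u))%:F / (\d_(repr u))%:F.
Proof.
have Hd : (\d_(repr u))%:F != 0 :> {fraction R}
  by rewrite tofrac_eq0 denom_ratioP.
apply: (mulIf Hd); rewrite divfK // -{1}[u]reprK; move: (repr u) => r {Hd}.
unlock FracField.tofrac; rewrite -[LHS]FracField.pi_mul.
apply/eqP; rewrite FracField.equivf_def /FracField.mulf.
rewrite !numden_Ratio ?mulf_neq0 ?oner_neq0 ?denom_ratioP //.
by rewrite !mulr1 mulrC.
Qed.

Lemma frac_eq a b c e : b != 0 -> e != 0 ->
  a%:F / b%:F = c%:F / e%:F :> {fraction R} <-> a * e = c * b.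
Proof.
move=> b0 e0; have E := @eqr_div {fraction R} a%:F b%:F c%:F e%:F.
rewrite !tofrac_eq0 -!tofracM tofrac_eq in E.
by split=> /eqP H; apply/eqP; move: H; rewrite E.
Qed.

Lemma fracP u : exists a b, b != 0 /\ u = a%:F / b%:F.
Proof.
by exists \n_(repr u), \d_(repr u); split; [apply: denom_ratioP|apply: frac_repr].
Qed.

End FracTheory.

Lemma frac_mapE (R S : idomainType) (f : {rmorphism R -> S}) (a b : R) :
  injective f -> b != 0 -> frac_map f (a%:F / b%:F) = (f a)%:F / (f b)%:F.
Proof.
move=> finj b0; have fnz c : c != 0 -> f c != 0.
  by move=> c0; rewrite -(rmorph0 f) (inj_eq finj).
have := frac_repr (a%:F / b%:F); rewrite /frac_map.
move: (repr _) => r; have q0 := denom_ratioP r.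
move/(frac_eq _ _ b0 q0) => E.
by apply: (proj2 (frac_eq _ _ (fnz _ q0) (fnz _ b0))); rewrite -!rmorphM E.
Qed.

Lemma frac_derivE (R : idomainType) (d : R -> R) (a b : R) :
  (forall p q, d (p * q) = d p * q + p * d q) ->
  b != 0 ->
  frac_deriv d (a%:F / b%:F) = (d a * b - a * d b)%:F / b%:F ^+ 2.
Proof.
move=> dM b0; have := frac_repr (a%:F / b%:F); rewrite /frac_deriv.
move: (repr _) => r; have := denom_ratioP r.
move: (\n_r) (\d_r) => p q q0 /=.
move/(frac_eq _ _ b0 q0) => E.
have E' : d a * q + a * d q = d p * b + p * d b by rewrite -!dM E.
rewrite -!tofracXn.
have [q2 b2] : q ^+ 2 != 0 /\ b ^+ 2 != 0 by rewrite !expf_neq0.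
apply: (proj2 (frac_eq _ _ q2 b2)).
have H : (d p * q - p * d q) * b ^+ 2 - (d a * b - a * d b) * q ^+ 2 =
    b * q * ((d p * b + p * d b) - (d a * q + a * d q)) +
    (b * d q + q * d b) * (a * q - p * b) by ring.
by apply/eqP; rewrite -subr_eq0 H E' E !subrr !mulr0 addr0.
Qed.

Lemma frac_deriv_tofrac (R : idomainType) (d : R -> R) (a : R) :
  (forall p q, d (p * q) = d p * q + p * d q) ->
  frac_deriv d a%:F = (d a)%:F.
Proof.
move=> dM.
have d1 : d 1 = 0.
  by apply: (addrI (d 1)); rewrite addr0 -{3}[1]mulr1 dM mulr1 mul1r.
have {1}-> : a%:F = a%:F / 1%:F :> {fraction R} by rewrite rmorph1 divr1.
rewrite frac_derivE ?oner_neq0 // d1 mulr0 subr0 mulr1.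
by rewrite rmorph1 expr1n divr1.
Qed.

Fact quotient_ruleM (F : fieldType) (a a' b b' c c' e e' : F) :
  b != 0 -> e != 0 ->
  ((a' * c + a * c') * (b * e) - a * c * (b' * e + b * e')) / (b * e) ^+ 2 =
  (a' * b - a * b') / b ^+ 2 * (c / e) + a / b * ((c' * e - c * e') / e ^+ 2).
Proof. by move=> b0 e0; field; rewrite b0 e0. Qed.

Fact quotient_ruleD (F : fieldType) (a a' b b' c c' e e' : F) :
  b != 0 -> e != 0 ->
  ((a' * e + a * e' + (c' * b + c * b')) * (b * e)
     - (a * e + c * b) * (b' * e + b * e')) / (b * e) ^+ 2 =
  (a' * b - a * b') / b ^+ 2 + (c' * e - c * e') / e ^+ 2.
Proof. by move=> b0 e0; field; rewrite b0 e0. Qed.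

Lemma frac_derivM (R : idomainType) (d : R -> R) (u v : {fraction R}) :
  (forall p q, d (p * q) = d p * q + p * d q) ->
  frac_deriv d (u * v) = frac_deriv d u * v + u * frac_deriv d v.
Proof.
move=> dM; have [a [b [b0 ->]]] := fracP u; have [c [e [e0 ->]]] := fracP v.
rewrite mulf_div -!tofracM !frac_derivE ?mulf_neq0 // !dM.
have bF : b%:F != 0 :> {fraction R} by rewrite tofrac_eq0.
have eF : e%:F != 0 :> {fraction R} by rewrite tofrac_eq0.
rewrite !tofracB !tofracM !tofracD !tofracM.
exact: quotient_ruleM bF eF.
Qed.

Lemma frac_derivD (R : idomainType) (d : R -> R) (u v : {fraction R}) :
  (forall p q, d (p + q) = d p + d q) ->
  (forall p q, d (p * q) = d p * q + p * d q) ->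
  frac_deriv d (u + v) = frac_deriv d u + frac_deriv d v.
Proof.
move=> dD dM; have [a [b [b0 ->]]] := fracP u; have [c [e [e0 ->]]] := fracP v.
have bF : b%:F != 0 :> {fraction R} by rewrite tofrac_eq0.
have eF : e%:F != 0 :> {fraction R} by rewrite tofrac_eq0.
rewrite addf_div // -!tofracM -tofracD !frac_derivE ?mulf_neq0 // dD !dM.
rewrite !tofracB !tofracM !tofracD !tofracM.
exact: quotient_ruleD bF eF.
Qed.

Lemma map_poly_derivM (F : fieldType) (d : F -> F) :
  (forall p q, d (p + q) = d p + d q) ->
  (forall p q, d (p * q) = d p * q + p * d q) ->
  forall p q : {poly F},
  map_poly d (p * q) = map_poly d p * q + p * map_poly d q.
Proof.
move=> dD dM p q.
have d0 : d 0 = 0 by apply: (addrI (d 0)); rewrite addr0 -dD addr0.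
have dsum I (r : seq I) (G : I -> F) : d (\sum_(i <- r) G i) = \sum_(i <- r) d (G i).
  by apply: (big_morph d dD d0).
apply/polyP=> i; rewrite coefD !coefM coef_map_id0 // coefM dsum -big_split /=.
by apply: eq_bigr => j _; rewrite dM !coef_map_id0.
Qed.

Lemma map_poly_derivD (F : fieldType) (d : F -> F) :
  (forall p q, d (p + q) = d p + d q) ->
  forall p q : {poly F}, map_poly d (p + q) = map_poly d p + map_poly d q.
Proof.
move=> dD p q.
have d0 : d 0 = 0 by apply: (addrI (d 0)); rewrite addr0 -dD addr0.
by apply/polyP=> i; rewrite !(coefD, coef_map_id0).
Qed.

Lemma map_poly_polyC (F : fieldType) (d : F -> F) (c : F) :
  d 0 = 0 -> map_poly d c%:P = (d c)%:P.
Proof.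
by move=> d0; apply/polyP=> i; rewrite coef_map_id0 // !coefC; case: eqP.
Qed.

Lemma map_poly_deriv_X (F : fieldType) (d : F -> F) :
  d 0 = 0 -> d 1 = 0 -> map_poly d 'X = 0.
Proof.
move=> d0 d1; apply/polyP=> i.
by rewrite coef_map_id0 // coefX coef0; case: eqP.
Qed.

Section Derivation.
Variable k : fieldType.

Lemma Dt0M (u v : ratfun k) : Dt0 (u * v) = Dt0 u * v + u * Dt0 v.
Proof. by apply: frac_derivM => p q; rewrite derivM. Qed.

Lemma Dt0D (u v : ratfun k) : Dt0 (u + v) = Dt0 u + Dt0 v.
Proof. by apply: frac_derivD => p q; rewrite (derivM, derivD). Qed.

Lemma Dt0_tofrac (p : {poly k}) : Dt0 p%:F = p^`()%:F.
Proof. by apply: frac_deriv_tofrac => a b; rewrite derivM. Qed.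

Lemma DtM (u v : ratfun (ratfun k)) : Dt (u * v) = Dt u * v + u * Dt v.
Proof. exact: frac_derivM (map_poly_derivM Dt0D Dt0M). Qed.

Lemma DtD (u v : ratfun (ratfun k)) : Dt (u + v) = Dt u + Dt v.
Proof. exact: frac_derivD (map_poly_derivD Dt0D) (map_poly_derivM Dt0D Dt0M). Qed.

Lemma Dt_tofrac (p : {poly ratfun k}) : Dt p%:F = (map_poly (@Dt0 k) p)%:F.
Proof. exact: frac_deriv_tofrac (map_poly_derivM Dt0D Dt0M). Qed.

Lemma Dt0_0 : Dt0 (0 : ratfun k) = 0.
Proof. by rewrite -tofrac0 Dt0_tofrac deriv0. Qed.

Lemma Dt_kt (e : ratfun k) : Dt e%:P%:F = (Dt0 e)%:P%:F.
Proof. by rewrite Dt_tofrac (map_poly_polyC _ Dt0_0). Qed.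

Lemma Dt_x : Dt ('X%:F : ratfun (ratfun k)) = 0.
Proof.
have D1 : Dt0 (1 : ratfun k) = 0 by rewrite -tofrac1 Dt0_tofrac derivC tofrac0.
by rewrite Dt_tofrac (map_poly_deriv_X Dt0_0 D1) tofrac0.
Qed.

End Derivation.

Lemma SxE (F : fieldType) (p q : {poly F}) : q != 0 ->
  Sx (p%:F / q%:F) = (p \Po ('X + 1))%:F / (q \Po ('X + 1))%:F.
Proof.
apply: (@frac_mapE _ _ (comp_poly ('X + 1))).
apply: (can_inj (g := fun r => r \Po ('X - 1))) => r.
rewrite -comp_polyA comp_polyD comp_polyX.
by rewrite -(polyC1 F) comp_polyC subrK comp_polyXr.
Qed.

Lemma extend_xE (F K : fieldType) (iota : {rmorphism F -> K})
    (p q : {poly F}) : q != 0 ->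
  extend_x iota (p%:F / q%:F) = (map_poly iota p)%:F / (map_poly iota q)%:F.
Proof. by apply: frac_mapE; apply: map_poly_inj. Qed.

(* Main.v *)
(* Suppose beta = beta_i is not in k, and let p be its minimal polynomial over
   k(t).  The polynomial D_t p is nonzero of smaller degree, so it does not
   vanish at beta; hence D_t raises the order of a pole at beta by exactly one,
   and L(f) keeps a pole at beta while it is regular at beta + z for every
   nonzero integer z.  No Delta_x(g) behaves like this, because g has finitely
   many poles.  Working with the p-adic order in k(t)(x) avoids extending D_t to
   the algebraic closure.

   Conversely, if every beta_i lies in k then f = P / Q with D_t Q = 0.  The
   derivatives D_t^l P lie in a finite-dimensional k(t)-space, and a linear
   relation between them is an operator L with L(f) = 0, so g = 0 works. *)

Require Import Defs.
From mathcomp Require Import all_boot all_order all_algebra.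
From mathcomp Require Import ring.
From Stdlib Require Import Classical.

Set Implicit Arguments.
Unset Strict Implicit.
Unset Printing Implicit Defensive.

Import GRing.Theory.
Local Open Scope ring_scope.

(** * Reduced fractions, and Delta_x of zero *)

Lemma frac_coprime (F : fieldType) (u : ratfun F) :
  exists a q : {poly F}, [/\ q != 0, coprimep a q & u = a%:F / q%:F].
Proof.
have [a [q [q0 ->]]] := fracP u.
have g0 : gcdp a q != 0 by rewrite gcdp_eq0 (negPf q0) andbF.
have q'0 : q %/ gcdp a q != 0 by rewrite dvdp_div_eq0 ?dvdp_gcdr.
exists (a %/ gcdp a q), (q %/ gcdp a q); split=> //.
  by rewrite coprimep_div_gcd // q0 orbT.
apply/(frac_eq _ _ q0 q'0).
have aE := divpK (dvdp_gcdl a q); have qE := divpK (dvdp_gcdr a q).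
by rewrite -[X in X * _]aE -[X in _ = _ * X]qE; ring.
Qed.

Lemma Deltax0 (F : fieldType) : Deltax (0 : ratfun F) = 0.
Proof.
have z : 0 = 0%:F / 1%:F :> ratfun F by rewrite tofrac0 mul0r.
by rewrite /Deltax subr0 [in LHS]z SxE ?oner_neq0 // comp_poly0 tofrac0 mul0r.
Qed.

(** * Values and regularity of rational functions at a point of an extension field *)

Section ValueAt.
Variables (F K : fieldType) (phi : {rmorphism F -> K}).
Implicit Types (a q : {poly F}) (u v : ratfun F) (b c : K).

Definition evalx b a : K := (map_poly phi a).[b].

Lemma evalxD b : {morph evalx b : a q / a + q}.
Proof. by move=> a q; rewrite /evalx rmorphD hornerD. Qed.

Lemma evalxM b : {morph evalx b : a q / a * q}.
Proof. by move=> a q; rewrite /evalx rmorphM hornerM. Qed.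

Lemma evalxC b (e : F) : evalx b e%:P = phi e.
Proof. by rewrite /evalx map_polyC hornerC. Qed.

Lemma evalx1 b : evalx b 1 = 1.
Proof. by rewrite -polyC1 evalxC rmorph1. Qed.

Lemma evalx_neq0 b q : evalx b q != 0 -> q != 0.
Proof. by apply: contraNneq => ->; rewrite /evalx rmorph0 horner0. Qed.

Lemma evalx_shift b a (s : F) : evalx b (a \Po ('X + s%:P)) = evalx (b + phi s) a.
Proof.
by rewrite /evalx map_comp_poly rmorphD /= map_polyX map_polyC horner_comp !hornerE.
Qed.

(** Coprimality survives extension of scalars, and coprime polynomials have no common root. *)
Lemma evalx_coprime b a q : coprimep a q -> evalx b q = 0 -> evalx b a != 0.
Proof.
move=> cop q0; have : coprimep (map_poly phi q) (map_poly phi a).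
  by rewrite coprimep_map coprimep_sym.
by move/coprimep_root; apply; apply/eqP.
Qed.

(** The graph of the residue map of the local ring at [b]: a relation, because evaluation is partial
    and a fraction has many representatives. *)
Definition value_at b u c :=
  exists a q, [/\ evalx b q != 0, u = a%:F / q%:F & c = evalx b a / evalx b q].

Lemma value_at_uniq b u c1 c2 : value_at b u c1 -> value_at b u c2 -> c1 = c2.
Proof.
move=> [a [q [q0 -> ->]]] [a' [q' [q'0 E ->]]].
move/(frac_eq _ _ (evalx_neq0 q0) (evalx_neq0 q'0)): E => E.
by apply/eqP; rewrite eqr_div // -!evalxM E.
Qed.

Lemma value_atD b u v c e :
  value_at b u c -> value_at b v e -> value_at b (u + v) (c + e).
Proof.
move=> [a [q [q0 -> ->]]] [a' [q' [q'0 -> ->]]].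
exists (a * q' + a' * q), (q * q'); split; first by rewrite evalxM mulf_neq0.
  by rewrite addf_div ?tofrac_eq0 ?(evalx_neq0 q0) ?(evalx_neq0 q'0) // -!tofracM -tofracD.
by rewrite addf_div // evalxD !evalxM.
Qed.

Lemma value_atM b u v c e :
  value_at b u c -> value_at b v e -> value_at b (u * v) (c * e).
Proof.
move=> [a [q [q0 -> ->]]] [a' [q' [q'0 -> ->]]].
exists (a * a'), (q * q'); split; first by rewrite evalxM mulf_neq0.
  by rewrite mulf_div -!tofracM.
by rewrite mulf_div -!evalxM.
Qed.

Lemma value_at_poly b a : value_at b a%:F (evalx b a).
Proof. by exists a, 1; rewrite evalx1 oner_neq0 tofrac1 !divr1. Qed.

Lemma value_at_nat b n : value_at b n%:R n%:R.
Proof.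
have := value_at_poly b n%:R; rewrite rmorph_nat.
by rewrite /evalx rmorph_nat -polyC_natr hornerC.
Qed.

Lemma value_atN b u c : value_at b u c -> value_at b (- u) (- c).
Proof.
move=> uc; rewrite -mulN1r -[- c]mulN1r; apply: value_atM => //.
have := value_at_poly b (- 1).
by rewrite tofracN tofrac1 /evalx rmorphN rmorph1 hornerN hornerC.
Qed.

Definition regular_at b u := exists c, value_at b u c.

Lemma regular_atP b u :
  regular_at b u <-> exists a q, evalx b q != 0 /\ u = a%:F / q%:F.
Proof.
split=> [[c [a [q [q0 -> _]]]]|[a [q [q0 ->]]]]; first by exists a, q.
by exists (evalx b a / evalx b q), a, q.
Qed.

Lemma regular_at_poly b a : regular_at b a%:F.
Proof. by exists (evalx b a); apply: value_at_poly. Qed.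

Lemma regular_atD b u v : regular_at b u -> regular_at b v -> regular_at b (u + v).
Proof. by move=> [c uc] [e ve]; exists (c + e); apply: value_atD. Qed.

Lemma regular_atM b u v : regular_at b u -> regular_at b v -> regular_at b (u * v).
Proof. by move=> [c uc] [e ve]; exists (c * e); apply: value_atM. Qed.

Lemma regular_atN b u : regular_at b u -> regular_at b (- u).
Proof. by move=> [c uc]; exists (- c); apply: value_atN. Qed.

Lemma regular_at_sum b (I : Type) (r : seq I) (G : I -> ratfun F) :
  (forall i, regular_at b (G i)) -> regular_at b (\sum_(i <- r) G i).
Proof.
move=> regG; elim/big_rec: _ => [|i u _]; last exact: regular_atD.
by rewrite -tofrac0; apply: regular_at_poly.
Qed.

(** Substituting x + 1 is invertible on polynomials, with inverse x - 1, so a representative with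
    good denominator on one side transports to the other. *)
Lemma regular_at_Sx b u : regular_at b (Sx u) <-> regular_at (b + 1) u.
Proof.
rewrite !regular_atP; have [a [q [q0 ->]]] := fracP u; rewrite SxE //.
have sK (c : {poly F}) : (c \Po ('X - 1)) \Po ('X + 1) = c.
  rewrite -comp_polyA comp_polyB comp_polyX -(polyC1 F) comp_polyC.
  by rewrite addrK comp_polyXr.
have sI : injective (fun c : {poly F} => c \Po ('X + 1)).
  apply: (can_inj (g := fun c : {poly F} => c \Po ('X - 1))) => c.
  rewrite -comp_polyA comp_polyD comp_polyX -(polyC1 F) comp_polyC.
  by rewrite subrK comp_polyXr.
have s0 (e : {poly F}) : e != 0 -> e \Po ('X + 1) != 0.
  by move=> e0; rewrite -(comp_poly0 ('X + 1)) (inj_eq sI).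
split=> [] [c [e [e0 E]]].
  have e1 := evalx_neq0 e0.
  move/(frac_eq _ _ (s0 _ q0) e1): E => E.
  have e'0 : e \Po ('X - 1) != 0.
    by apply: contraNneq e1 => e'0; rewrite -(sK e) e'0 comp_poly0.
  exists (c \Po ('X - 1)), (e \Po ('X - 1)); split.
    by rewrite -polyC1 -polyCN evalx_shift rmorphN rmorph1 addrK.
  by apply/(frac_eq _ _ q0 e'0); apply: sI; rewrite !comp_polyM !sK.
have e1 := evalx_neq0 e0; move/(frac_eq _ _ q0 e1): E => E.
exists (c \Po ('X + 1)), (e \Po ('X + 1)); split.
  by rewrite -polyC1 evalx_shift rmorph1.
by apply/(frac_eq _ _ (s0 _ q0) (s0 _ e1)); rewrite -!comp_polyM E.
Qed.

Lemma exists_regular_at b (s : K) u : [pchar K] =i pred0 ->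
  s != 0 -> exists2 n : nat, (0 < n)%N & regular_at (b + s * n%:R) u.
Proof.
move=> charK s0; have [a [q [q0 ->]]] := fracP u.
have qK0 : map_poly phi q != 0 by rewrite map_poly_eq0.
(* These [size q] points are distinct in characteristic zero, too many to be all roots of the
   denominator. *)
pose rs := [seq b + s * n%:R | n <- iota 1 (size q)].
have rsU : uniq rs.
  rewrite map_inj_uniq ?iota_uniq // => n1 n2 /addrI /(mulfI s0) /eqP.
  wlog le_n : n1 n2 / (n1 <= n2)%N.
    by move=> W; case/orP: (leq_total n1 n2) => /W // W' E; apply/esym/W'; rewrite eq_sym.
  rewrite eq_sym -subr_eq0 -natrB // (proj1 (pcharf0P _) charK) subn_eq0 => le2.
  by apply/eqP; rewrite eqn_leq le_n.
have /allPn[x /mapP[n]] : ~~ all (root (map_poly phi q)) rs.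
  apply: contraL (leqnn (size q)) => rsR; rewrite -ltnNge.
  by have := max_poly_roots qK0 rsR rsU; rewrite size_map size_iota size_map_poly.
rewrite mem_iota => /andP[n_gt0 _] -> nr; exists n => //.
by apply/regular_atP; exists a, q.
Qed.

(* Regularity of g propagates along the orbit b + Z downwards from +oo to b + 1
   and upwards from -oo to b, so both S_x g and g are regular at b. *)
Lemma regular_at_Deltax b (g : ratfun F) : [pchar K] =i pred0 ->
  (forall z : int, z != 0 -> regular_at (b + z%:~R) (Deltax g)) ->
  regular_at b (Deltax g).
Proof.
move=> charK regD.
have reg1 : regular_at (b + 1) g.
  have [[//|n] _] := exists_regular_at b g charK (oner_neq0 K); rewrite mul1r.
  elim: n => // n IHn reg; apply: IHn.
  have -> : g = Sx g - Deltax g by rewrite /Deltax opprB addrC subrK.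
  apply: regular_atD; last by apply/regular_atN/(regD n.+1%:Z).
  by apply/regular_at_Sx; rewrite -addrA natr1.
have reg0 : regular_at b g.
  have N1 : - 1 != 0 :> K by rewrite oppr_eq0 oner_neq0.
  have [n _] := exists_regular_at b g charK N1; rewrite mulN1r.
  elim: n => [|n IHn reg]; first by rewrite subr0.
  apply: IHn; have -> : b - n%:R = b - n.+1%:R + 1.
    by rewrite -natr1 opprD addrA subrK.
  apply/regular_at_Sx; have -> : Sx g = g + Deltax g by rewrite addrC subrK.
  apply: regular_atD => //.
  by have := regD (- n.+1%:Z) isT; rewrite rmorphN.
by apply: regular_atD; [apply/regular_at_Sx|apply: regular_atN].
Qed.

(** * Minimal polynomials and division by them *)

Lemma min_annihilator b : algebraicOver phi b ->
  exists p, [/\ p \is monic, evalx b p = 0 &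
    forall a, (size a < size p)%N -> evalx b a = 0 -> a = 0].
Proof.
case=> p p0 /eqP; have [n] := ubnP (size p).
elim: n p p0 => // n IHn p p0 /ltnSE le_p pb.
(* Descent on the size: either a smaller annihilator exists, or [p] is minimal and only has to be
   made monic. *)
have [[a [a0 lt_a ab]]|min_p] :=
    classic (exists a, [/\ a != 0, (size a < size p)%N & evalx b a = 0]).
  exact: IHn a a0 (leq_trans lt_a le_p) ab.
have l0 : (lead_coef p)^-1 != 0 by rewrite invr_eq0 lead_coef_eq0.
exists ((lead_coef p)^-1 *: p); split.
- by rewrite monicE lead_coefZ mulVf ?lead_coef_eq0.
- by rewrite -mul_polyC evalxM /(evalx b p) pb mulr0.
- move=> a; rewrite size_scale // => lt_a ab; apply/eqP.
  by apply: contra_notT min_p => a0; exists a.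
Qed.

(** As long as [q] vanishes at [b], its remainder modulo [p] vanishes there too and is 0 by
    minimality, so a factor [p] splits off. *)
Lemma factor_out_annihilator b p q : p \is monic -> evalx b p = 0 ->
    (forall a, (size a < size p)%N -> evalx b a = 0 -> a = 0) -> q != 0 ->
  exists n q', evalx b q' != 0 /\ q = q' * p ^+ n.
Proof.
move=> mp pb min_p; have p0 := monic_neq0 mp.
have [n] := ubnP (size q).
elim: n q => // n IHn q /ltnSE le_q q0.
have [qb|] := eqVneq (evalx b q) 0; last first.
  by exists 0%N, q; rewrite expr0 mulr1.
have qE : q = q %/ p * p.
  rewrite {1}(divp_eq q p) [q %% p]min_p ?addr0 // ?ltn_modp //.
  by move: qb; rewrite {1}(divp_eq q p) evalxD evalxM pb mulr0 add0r.
have q'0 : q %/ p != 0 by apply: contraNneq q0 => E; rewrite qE E mul0r.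
(* A monic constant is 1, which does not vanish at [b]; so [p] is not constant and the quotient is
   smaller. *)
have p_gt1 : (1 < size p)%N.
  rewrite ltnNge; apply: contraL (oner_neq0 K) => /size1_polyC pC.
  move: mp pb; rewrite pC monicE lead_coefC => /eqP ->.
  by rewrite evalxC rmorph1 => ->; rewrite eqxx.
have [|//|m [q' [q'b E]]] := IHn (q %/ p).
  apply: leq_trans le_q; rewrite {2}qE size_mul //.
  by case: (size p) p_gt1 => [|[|s]] // _; rewrite addnS /= addnS ltnS leq_addr.
by exists m.+1, q'; split=> //; rewrite qE E exprSr mulrA.
Qed.

End ValueAt.

(** * Effect of D_t and of operators on poles *)

Section Poles.
Variables (k : fieldType) (K : fieldType) (phi : {rmorphism ratfun k -> K}).
Implicit Types (a p q : {poly ratfun k}) (u v : ratfun (ratfun k)) (b c : K).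

Lemma Dt_frac a q : q != 0 -> Dt (a%:F / q%:F) =
  (map_poly (@Dt0 k) a * q - a * map_poly (@Dt0 k) q)%:F / q%:F ^+ 2.
Proof. exact: frac_derivE (map_poly_derivM (@Dt0D k) (@Dt0M k)). Qed.

Lemma regular_at_Dt b u : regular_at phi b u -> regular_at phi b (Dt u).
Proof.
rewrite !regular_atP => -[a [q [q0 ->]]]; rewrite Dt_frac ?(evalx_neq0 q0) //.
rewrite -tofracXn; eexists _, _; split; last by [].
by rewrite expr2 evalxM mulf_neq0.
Qed.

Lemma regular_at_iter_Dt b u l :
  regular_at phi b u -> regular_at phi b (iter l (@Dt k) u).
Proof. by move=> ru; elim: l => //= l; apply: regular_at_Dt. Qed.

Lemma regular_at_diffop_app b (L : diffop k) u :
  regular_at phi b u -> regular_at phi b (diffop_app L u).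
Proof.
move=> ru; apply: regular_at_sum => l.
by apply: regular_atM; [apply: regular_at_poly|apply: regular_at_iter_Dt].
Qed.

Lemma DtX u n : Dt (u ^+ n.+1) = n.+1%:R * u ^+ n * Dt u.
Proof.
elim: n => [|n IHn]; first by rewrite expr0 expr1 !mul1r.
by rewrite exprS DtM IHn -[n.+2%:R]natr1 !exprS; move: n.+1%:R (u ^+ n) => N w; ring.
Qed.

Section AtAnnihilator.
Variables (b : K) (p : {poly ratfun k}).
Hypotheses (charK : [pchar K] =i pred0) (pb : evalx phi b p = 0).
Hypothesis (Dpb : evalx phi b (map_poly (@Dt0 k) p) != 0).

(** Pole order measured by powers of [p] rather than of x - b: everything stays in k(t)(x), where
    D_t is defined. *)
Definition pole_order_at n u :=
  exists2 c, c != 0 & value_at phi b (u * p%:F ^+ n) c.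

(** If [u] were regular, u * p^(n+1) would take the value 0 at [b], against uniqueness of values. *)
Lemma pole_order_at_not_regular n u : pole_order_at n.+1 u -> ~ regular_at phi b u.
Proof.
move=> [c c0 uc] [e ue].
have pX : value_at phi b (p%:F ^+ n.+1) 0.
  rewrite -tofracXn -(_ : evalx phi b (p ^+ n.+1) = 0); first exact: value_at_poly.
  by rewrite exprS evalxM pb mul0r.
by move: c0; rewrite (value_at_uniq uc (value_atM ue pX)) mulr0 eqxx.
Qed.

Lemma pole_order_at_Dt n u : pole_order_at n.+1 u -> pole_order_at n.+2 (Dt u).
Proof.
move=> [c c0 uc]; set Dp := map_poly (@Dt0 k) p.
exists (- (n.+1%:R * c * evalx phi b Dp)).
  by rewrite oppr_eq0 !mulf_neq0 // (proj1 (pcharf0P _) charK).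
(* Leibniz rule for u * p^(n+1). The first term on the right is a regular function times [p], so it
   vanishes at [b]; the second gives the nonzero value. *)
have -> : Dt u * p%:F ^+ n.+2 =
    Dt (u * p%:F ^+ n.+1) * p%:F - n.+1%:R * (u * p%:F ^+ n.+1) * Dp%:F.
  by rewrite DtM DtX Dt_tofrac -/Dp !exprS; ring.
have [e De] : regular_at phi b (Dt (u * p%:F ^+ n.+1)).
  by apply: regular_at_Dt; exists c.
rewrite -[X in value_at _ _ _ X]add0r -(mulr0 e) -[in e * _]pb.
apply: value_atD; first by apply: value_atM => //; apply: value_at_poly.
apply: value_atN; apply: value_atM; last exact: value_at_poly.
by apply: value_atM => //; apply: value_at_nat.
Qed.

Lemma pole_order_at_iter_Dt n l u :
  pole_order_at n.+1 u -> pole_order_at (n + l).+1 (iter l (@Dt k) u).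
Proof.
move=> pu; elim: l => [|l IHl]; first by rewrite addn0.
by rewrite addnS; apply: pole_order_at_Dt.
Qed.

(** Each D_t adds one to the pole order, so the leading term of [L] has strictly the highest order
    and cannot be cancelled. *)
Lemma pole_order_at_diffop_app n (L : diffop k) u : L != 0 ->
  pole_order_at n.+1 u -> exists l, pole_order_at (n + l).+1 (diffop_app L u).
Proof.
move=> L0 pu; have := L0; rewrite -size_poly_gt0 /diffop_app.
case sL : (size L) => [//|s] _; exists s.
have [c c0 lead_val] := pole_order_at_iter_Dt s pu.
exists (phi L`_s * c).
  rewrite mulf_neq0 // fmorph_eq0.
  by rewrite (_ : L`_s = lead_coef L) ?lead_coef_eq0 // lead_coefE sL.
(* The terms of index l < s have order at most n + s, so p^(n+s) already clears their poles; the
   remaining factor [p] makes them vanish at [b]. *)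
have reg_low : regular_at phi b
    ((\sum_(l < s) (L`_l)%:P%:F * iter l (@Dt k) u) * p%:F ^+ (n + s)).
  rewrite mulr_suml; apply: regular_at_sum => l; rewrite -mulrA.
  apply: regular_atM; first exact: regular_at_poly.
  have -> : (n + s = (n + l).+1 + (s - l.+1))%N.
    by rewrite -addnS -addnA subnKC.
  rewrite exprD mulrA; apply: regular_atM.
    by have [e _ ue] := pole_order_at_iter_Dt l pu; exists e.
  by rewrite -tofracXn; apply: regular_at_poly.
case: reg_low => e low_val.
rewrite big_ord_recr /= mulrDl -[X in value_at _ _ _ X]add0r -(mulr0 e) -[in e * _]pb.
apply: value_atD.
  by rewrite exprSr mulrA; apply: value_atM => //; apply: value_at_poly.
by rewrite -mulrA -(evalxC _ b); apply: value_atM => //; apply: value_at_poly.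
Qed.

End AtAnnihilator.

(** * Constants of D_t *)

Lemma deriv_eq0_polyC (a : {poly k}) : [pchar k] =i pred0 ->
  a^`() = 0 -> a = (a`_0)%:P.
Proof.
move=> char0 Da; apply: size1_polyC; apply/leq_sizeP => -[//|i] _.
have := coef_deriv a i; rewrite Da coef0 => /esym/eqP.
by rewrite -mulr_natr mulf_eq0 (proj1 (pcharf0P _) char0) orbF => /eqP.
Qed.

Lemma Dt0_eq0 (w : ratfun k) : [pchar k] =i pred0 ->
  Dt0 w = 0 -> exists c : k, w = cst_kt c.
Proof.
move=> char0; have [a [q [q0 cop ->]]] := frac_coprime w.
rewrite /Dt0 frac_derivE // => [|? ?]; last by rewrite derivM.
move/eqP; rewrite mulf_eq0 invr_eq0 expf_eq0 /= !tofrac_eq0 (negPf q0) orbF.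
rewrite subr_eq0 => /eqP E.
(* From a' q = a q' and coprimality, q divides q', which has smaller degree. *)
have Dq : q^`() = 0.
  apply/eqP; apply: contraT => Dq0.
  have : q %| a * q^`() by rewrite -E dvdp_mull.
  by rewrite Gauss_dvdpr 1?coprimep_sym // => /(dvdp_leq Dq0); rewrite leqNgt lt_size_deriv.
have Da : a^`() = 0.
  by move/eqP: E; rewrite Dq mulr0 mulf_eq0 (negPf q0) orbF => /eqP.
exists (a`_0 / q`_0); rewrite /cst_kt.
have qC := deriv_eq0_polyC char0 Dq.
have q'0 : q`_0 != 0 by apply: contraNneq q0 => E'; rewrite qC E'.
rewrite {1}(deriv_eq0_polyC char0 Da) {1}qC.
apply: (mulIf (x := (q`_0)%:P%:F)); first by rewrite tofrac_eq0 polyC_eq0.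
by rewrite divfK ?tofrac_eq0 ?polyC_eq0 // -tofracM -polyCM divfK.
Qed.

Notation cst := (@FracField.tofrac {poly k} \o polyC).

Lemma map_poly_Dt0_eq0 (p : {poly ratfun k}) : [pchar k] =i pred0 ->
  map_poly (@Dt0 k) p = 0 -> exists p0 : {poly k}, p = map_poly cst p0.
Proof.
move=> char0 Dp.
have {Dp} : forall i, Dt0 p`_i = 0.
  by move=> i; rewrite -(coef_map_id0 _ _ (Dt0_0 k)) Dp coef0.
elim/poly_ind: p => [_|p e IHp Dp]; first by exists 0; rewrite rmorph0.
have [i|p0 ->] := IHp; first by have := Dp i.+1; rewrite coefD coefMX coefC addr0.
have [|c ->] := @Dt0_eq0 e char0; first by have := Dp 0; rewrite coefD coefMX coefC add0r.
by exists (p0 * 'X + c%:P); rewrite rmorphD rmorphM /= map_polyX map_polyC.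
Qed.

Lemma map_poly_Dt0_cst (p0 : {poly k}) : map_poly (@Dt0 k) (map_poly cst p0) = 0.
Proof.
apply/polyP=> i; rewrite coef_map_id0 ?Dt0_0 // coef_map /= coef0.
by rewrite Dt0_tofrac derivC tofrac0.
Qed.

(** The leading coefficient 1 has derivative 0. *)
Lemma size_map_poly_Dt0 (p : {poly ratfun k}) : p \is monic ->
  (size (map_poly (@Dt0 k) p) < size p)%N.
Proof.
move=> mp; have := monic_neq0 mp; rewrite -size_poly_gt0.
case sp : (size p) => [//|s] _; rewrite ltnS; apply/leq_sizeP => i le_i.
rewrite coef_map_id0 ?Dt0_0 //; move: le_i; rewrite leq_eqVlt => /orP[/eqP<-|lt_i].
  have -> : p`_s = 1 by move/monicP: mp; rewrite lead_coefE sp.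
  by rewrite -tofrac1 Dt0_tofrac derivC tofrac0.
by rewrite nth_default ?sp // Dt0_0.
Qed.

End Poles.

(** Otherwise D_t p, smaller than [p], is 0 by minimality. Then [p] has coefficients in k and splits
    over k, so its root [b] lies in k. *)
Lemma evalx_Dt0_neq0 (k : closedFieldType) (K : fieldType)
    (phi : {rmorphism ratfun k -> K}) (b : K) (p : {poly ratfun k}) :
    [pchar k] =i pred0 -> p \is monic -> evalx phi b p = 0 ->
    (forall a : {poly ratfun k}, (size a < size p)%N -> evalx phi b a = 0 -> a = 0) ->
    ~ (exists c : k, b = phi (cst_kt c)) ->
  evalx phi b (map_poly (@Dt0 k) p) != 0.
Proof.
move=> char0 mp pb min_p nb; apply/eqP => Dpb; apply: nb.
have [p0 pE] := map_poly_Dt0_eq0 char0 (min_p _ (size_map_poly_Dt0 mp) Dpb).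
have [r rE] := closed_field_poly_normal p0.
have l0 : lead_coef p0 != 0.
  by rewrite lead_coef_eq0; apply: contraTneq mp => p00;
    rewrite pE p00 rmorph0 monicE lead_coef0 eq_sym oner_eq0.
move/eqP: pb; rewrite pE rE -mul_polyC rmorphM /= map_polyC /= evalxM mulf_eq0.
rewrite evalxC fmorph_eq0 tofrac_eq0 polyC_eq0 (negPf l0) /=.
rewrite /evalx !rmorph_prod horner_prod prodf_seq_eq0 => /hasP[c _].
rewrite /= rmorphB /= map_polyX map_polyC rmorphB /= map_polyX map_polyC.
by rewrite hornerXsubC subr_eq0 => /eqP ->; exists c.
Qed.

(** * Annihilating operators by linear algebra over k(t) *)

Lemma annihilating_diffop (k : fieldType) (P : {poly ratfun k}) :
  exists2 L : diffop k, L != 0 &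
    \sum_(l < size L) (L`_l)%:P * iter l (map_poly (@Dt0 k)) P = 0.
Proof.
set D := map_poly _; set N := size P.
have le_N l : (size (iter l D P) <= N)%N.
  by elim: l => //= l; apply: leq_trans; apply: size_poly.
(* The N + 1 rows are the coefficients of P and of its first N derivatives, all of size at most N; a
   left kernel vector gives the coefficients of [L]. *)
pose M : 'M_(N.+1, N) := \matrix_(l, j) (iter l D P)`_j.
have : kermx M != 0.
  by rewrite kermx_eq0 /row_free; apply: contraTneq (rank_leq_col M) => ->; rewrite ltnn.
case/rowV0Pn=> v /sub_kermxP vM v0.
pose w (l : nat) := v 0 (inord l).
have wE (i : 'I_N.+1) : w i = v 0 i by rewrite /w inord_val.
have L0 : \poly_(l < N.+1) w l != 0.
  case/rV0Pn: v0 => i vi; apply: contraNneq vi => /(congr1 (fun q : {poly _} => q`_i)).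
  by rewrite coef_poly ltn_ord wE coef0 => ->.
exists (\poly_(l < N.+1) w l) => //; set L := \poly_(_ < _) _.
have sL : (size L <= N.+1)%N by apply: size_poly.
(* [L] may have size below N + 1; the sum is padded with zero terms to match the kernel relation. *)
rewrite (big_ord_widen _ (fun l => (L`_l)%:P * iter l D P) sL) big_mkcond /=.
apply/polyP=> j; rewrite coef_sum coef0.
have [lt_j|le_j] := ltnP j N; last first.
  rewrite big1 // => l _; case: ifP => _; last by rewrite coef0.
  by rewrite coefCM [X in _ * X]nth_default ?mulr0 // (leq_trans (le_N l)).
have /matrixP/(_ 0 (Ordinal lt_j)) := vM; rewrite !mxE => vMj; rewrite -[RHS]vMj.
apply: eq_bigr => l _; rewrite mxE; case: ifP => [_|/negbT].
  by rewrite coefCM coef_poly ltn_ord wE.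
rewrite -leqNgt => le_l; rewrite -wE.
by have := coef_poly N.+1 w l; rewrite ltn_ord nth_default // => <-; rewrite coef0 mul0r.
Qed.

(** * Partial fractions over a common denominator *)

Section PartialFractions.
Variables (K : fieldType) (m : nat) (n : 'I_m -> nat).
Variables (beta : 'I_m -> K) (alpha : 'I_m -> nat -> K).

Definition pf_denom : {poly K} := \prod_(i < m) ('X - (beta i)%:P) ^+ n i.

Definition pf_numer : {poly K} :=
  \sum_(i < m) \sum_(1 <= j < (n i).+1)
    (alpha i j)%:P * ('X - (beta i)%:P) ^+ (n i - j)
      * \prod_(i' < m | i' != i) ('X - (beta i')%:P) ^+ n i'.

Lemma pf_denom_neq0 : pf_denom != 0.
Proof. by apply/prodf_neq0 => i _; rewrite expf_neq0 // polyXsubC_eq0. Qed.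

Lemma sum_simple_fraction :
  \sum_(i < m) \sum_(1 <= j < (n i).+1) simple_fraction (alpha i j) (beta i) j
    = pf_numer%:F / pf_denom%:F.
Proof.
apply: (mulIf (x := pf_denom%:F)); first by rewrite tofrac_eq0 pf_denom_neq0.
rewrite divfK ?tofrac_eq0 ?pf_denom_neq0 // /pf_numer rmorph_sum mulr_suml.
apply: eq_bigr => i _; rewrite rmorph_sum mulr_suml.
apply: eq_big_nat => j /andP[_ lt_j]; rewrite !rmorphM /=.
rewrite /pf_denom (bigD1 i) //= rmorphM /= mulrA; congr (_ * _).
rewrite /simple_fraction -(subnK (ltnSE lt_j)) addnK exprD rmorphM /=.
rewrite [X in _ * X]mulrC mulrA !tofracXn; congr (_ * _).
by rewrite divfK // expf_neq0 // tofrac_eq0 polyXsubC_eq0.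
Qed.

Lemma horner_pf_denom_eq0 b : pf_denom.[b] = 0 -> exists i, b = beta i.
Proof.
move/eqP; rewrite horner_prod => /prodf_eq0[i _].
by rewrite horner_exp hornerXsubC expf_eq0 subr_eq0 => /andP[_ /eqP]; exists i.
Qed.

Lemma horner_pf_denom_beta i : (0 < n i)%N -> pf_denom.[beta i] = 0.
Proof.
move=> n_gt0; rewrite horner_prod (bigD1 i) //= horner_exp hornerXsubC subrr.
by rewrite expr0n gtn_eqF // mul0r.
Qed.

(** Only the term of index (i, n_i) survives at beta_i: every other one keeps a factor x -
    beta_i. *)
Lemma horner_pf_numer_beta i : injective beta -> (0 < n i)%N ->
  alpha i (n i) != 0 -> pf_numer.[beta i] != 0.
Proof.
move=> beta_inj n_gt0 alpha0; rewrite /pf_numer (bigD1 i) //= hornerD.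
rewrite [X in _ + X]horner_sum [X in _ + X]big1 => [|i' ne_i]; last first.
  rewrite horner_sum big1_seq // => j _.
  rewrite hornerM [X in _ * X]horner_prod (bigD1 i) 1?eq_sym //= horner_exp hornerXsubC subrr.
  by rewrite expr0n gtn_eqF // mul0r mulr0.
rewrite addr0 big_nat_recr //= subnn expr0 mulr1 hornerD horner_sum.
rewrite big_nat_cond big1 => [|j]; last first.
  rewrite andbT => /andP[_ lt_j]; rewrite !hornerM horner_exp hornerXsubC subrr.
  by rewrite expr0n subn_eq0 leqNgt lt_j mulr0 mul0r.
rewrite add0r hornerM hornerC mulf_neq0 // horner_prod.
apply/prodf_neq0 => i' ne_i; rewrite horner_exp hornerXsubC expf_neq0 // subr_eq0.
by rewrite (inj_eq beta_inj) eq_sym.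
Qed.

End PartialFractions.

(** * Operators with L(f) = Delta_x(g) and constancy of the poles *)

Theorem theorem4p9
    (k : closedFieldType) (char0 : [pchar k] =i pred0)
    (K : closedFieldType) (iota : {rmorphism ratfun k -> K})
    (Kclosure : is_algebraic_closure iota)
    (f : ratfun (ratfun k))
    (m : nat) (n : 'I_m -> nat) (beta : 'I_m -> K) (alpha : 'I_m -> nat -> K)
    (n_gt0 : forall i : 'I_m, (0 < n i)%N)
    (f_eq : extend_x iota f =
       \sum_(i < m) \sum_(1 <= j < (n i).+1)
          simple_fraction (alpha i j) (beta i) j)
    (alpha_neq0 : forall i : 'I_m, alpha i (n i) != 0)
    (beta_shift : forall i i' : 'I_m, i != i' ->
       forall z : int, beta i - beta i' != z%:~R) :
  (exists (L : diffop k) (g : ratfun (ratfun k)),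
      L != 0 /\ diffop_app L f = Deltax g)
  <->
  (forall i : 'I_m, exists c : k, beta i = iota (cst_kt c)).
Proof.
have charK : [pchar K] =i pred0.
  have cst_char := fmorph_pchar (iota \o (@FracField.tofrac {poly k} \o polyC)).
  by move=> x; rewrite cst_char char0.
have beta_inj : injective beta.
  (* The shift z = 0 already separates the beta_i. *)
  move=> i i' E; apply/eqP; apply: contraT => /beta_shift/(_ 0).
  by rewrite E subrr eqxx.
have [a [q [q0 cop fE]]] := frac_coprime f.
have aqE : map_poly iota a * pf_denom n beta = pf_numer n beta alpha * map_poly iota q.
  apply/frac_eq; rewrite ?map_poly_eq0 ?pf_denom_neq0 //.
  by rewrite -extend_xE // -fE f_eq sum_simple_fraction.
(* This and the next claim identify the roots of the reduced denominator [q] with the beta_i, by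
   evaluating the cross-multiplied identity. *)
have q_root b : evalx iota b q = 0 -> exists i, b = beta i.
  move=> qb; apply: (horner_pf_denom_eq0 (n := n)); apply/eqP.
  have := congr1 (fun c : {poly K} => c.[b]) aqE; rewrite !hornerM.
  rewrite -!/(evalx iota b _) qb mulr0 => /eqP; rewrite mulf_eq0.
  by rewrite (negPf (evalx_coprime cop qb)).
have q_beta i : evalx iota (beta i) q = 0.
  have := congr1 (fun c : {poly K} => c.[beta i]) aqE; rewrite !hornerM.
  rewrite horner_pf_denom_beta // mulr0 => /esym/eqP; rewrite mulf_eq0.
  by rewrite (negPf (horner_pf_numer_beta beta_inj (n_gt0 i) (alpha_neq0 i))) => /eqP.
split=> [[L [g [L0 Lf]]] i|beta_cst].
  apply: NNPP => nb; pose b := beta i.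
  have [p [mp pb min_p]] := min_annihilator (Kclosure b).
  have Dpb := evalx_Dt0_neq0 char0 mp pb min_p nb.
  have p0 := monic_neq0 mp.
  (* Exponent 0 is excluded because [q] vanishes at beta_i. *)
  have [[|s] [q' [q'b qE]]] := factor_out_annihilator mp pb min_p q0.
    by move: q'b; rewrite -[q']mulr1 -(expr0 p) -qE q_beta eqxx.
  have pf : pole_order_at iota b p s.+1 f.
    exists (evalx iota b a / evalx iota b q').
      by rewrite mulf_neq0 ?invr_eq0 // (evalx_coprime cop (q_beta i)).
    have pX0 : (p ^+ s.+1)%:F != 0 :> ratfun (ratfun k) by rewrite tofrac_eq0 expf_neq0.
    by exists a, q'; split=> //; rewrite fE qE -tofracXn tofracM invfM mulrA (divfK pX0).
  have [l] := pole_order_at_diffop_app charK pb Dpb L0 pf.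
  move/(pole_order_at_not_regular pb); apply; rewrite Lf.
  apply: (regular_at_Deltax charK) => z z0; rewrite -Lf.
  (* A pole of f at b + z would be some beta_i': the integer-shift hypothesis excludes i' different
     from i, and i' = i forces z = 0. *)
  apply: regular_at_diffop_app; apply/regular_atP; exists a, q; split=> //.
  apply/eqP => /q_root[i' E].
  have [ii'|/beta_shift/(_ z)] := eqVneq i' i; last first.
    by rewrite -E addrAC subrr add0r eqxx.
  have /eqP : z%:~R = 0 :> K by apply: (addrI b); rewrite addr0 E ii'.
  move: z z0 {E} => [] z z0.
    by rewrite (proj1 (pcharf0P _) charK) => /eqP E; rewrite E in z0.
  by rewrite NegzE rmorphN /= oppr_eq0 (proj1 (pcharf0P _) charK).
have [c cE] : exists c : 'I_m -> k, forall i, beta i = iota (cst_kt (c i)).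
  have := fin_all_exists beta_cst; exact.
pose cst := @FracField.tofrac {poly k} \o polyC.
(* The common denominator descends to k[x], so D_t kills it and acts on f through the numerator
   alone. *)
pose Q0 : {poly k} := \prod_(i < m) ('X - (c i)%:P) ^+ n i.
pose Q := map_poly cst Q0.
have QE : map_poly iota Q = pf_denom n beta.
  rewrite /Q /Q0 /pf_denom !rmorph_prod; apply: eq_bigr => i _ /=.
  by rewrite !rmorphXn /= !rmorphB /= !map_polyX !map_polyC cE.
have Q_neq0 : Q != 0 by rewrite -(map_poly_eq0 iota) QE pf_denom_neq0.
have [P PE] : exists P, f = P%:F / Q%:F.
  (* Divisibility holds over K and descends to k(t); as [q] is coprime to [a], it divides [Q]. *)
  have : q %| a * Q.
    by rewrite -(dvdp_map iota) rmorphM /= QE aqE dvdp_mull.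
  rewrite Gauss_dvdpr 1?coprimep_sym // => /dvdpP[r rE]; exists (a * r).
  by rewrite fE; apply/frac_eq => //; rewrite rE; ring.
have DtMQ w : Dt (w * Q%:F) = Dt w * Q%:F.
  by rewrite DtM Dt_tofrac map_poly_Dt0_cst tofrac0 mulr0 addr0.
have QF0 : Q%:F != 0 :> ratfun (ratfun k) by rewrite tofrac_eq0.
have iterE l : iter l (@Dt k) f = (iter l (map_poly (@Dt0 k)) P)%:F / Q%:F.
  elim: l => // l /= ->; apply: (mulIf QF0).
  by rewrite -DtMQ !(divfK QF0) Dt_tofrac.
have [L L0 LP] := annihilating_diffop P.
exists L, 0; split=> //; rewrite Deltax0 /diffop_app.
rewrite (eq_bigr (fun l : 'I__ => ((L`_l)%:P * iter l (map_poly (@Dt0 k)) P)%:F / Q%:F)).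
  by rewrite -mulr_suml -rmorph_sum LP rmorph0 mul0r.
by move=> l _; rewrite iterE rmorphM mulrA.
Qed.
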